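(* For every real $q>2$ there is a positive constant $C_q$ depending only on $q$ such that the following holds. Let $r>0$. For each $N\in\mathbb N$, let $Z^{(N)}_i:\Omega\to D_{\uparrow}$, $i=1,2,\ldots,N$, be a sequence of independent, $D_{\uparrow}$ valued random variables, let $M^{(N)}$ be a positive real, and let $w^{(N)}_i$, $i=1,2,\ldots,N$, be a sequence of non-negative reals. Assume that for each $N\in\mathbb N$ and $i=1,2,\ldots,N$: (i) $\mathrm E[\,|Z^{(N)}_i(T)-Z^{(N)}_i(0)|^q\,]^{1/q}\le M^{(N)}$; (ii) $|\mathrm E[Z^{(N)}_i(t)]-\mathrm E[Z^{(N)}_i(s)]|\le M^{(N)}w^{(N)}_i\,|t-s|^r$ for all $s,t\in[0,T]$. Put $\bar w^{(N)}=\frac1N\sum_{i=1}^N w^{(N)}_i$, and let $N_0$ be the smallest positive integer satisfying $N_0^{qr/(2qr+2r+2)}\ge 2$. Then the arithmetic average $Y^{(N)}(t)=\frac1N\sum_{i=1}^N Z^{(N)}_i(t)$ satisfies $$\mathrm E\Bigl[\sup_{(t_1,t_2)\in\Delta}|Y^{(N)}(t_2)-Y^{(N)}(t_1)-\mathrm E[Y^{(N)}(t_2)-Y^{(N)}(t_1)]|^q\Bigr]\le \frac{(M^{(N)})^q\,2^{q-1}}{N^{q^2r/(2qr+2r+2)}}\Bigl(C_q^q\,\bigl(2T\,(\bar w^{(N)})^{1/r}+1\bigr)+2^{2q}\Bigr)$$ for all integers $N=N_0,N_0+1,\ldots$. If in addition $\{M^{(N)},\bar w^{(N)}\}$ is bounded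 (i.e. both sequences are bounded in $N$) and $(q^2-2q-2)\,r>2$ holds, then $$\lim_{N\to\infty}\sup_{(t_1,t_2)\in\Delta}\Bigl|\frac1N\sum_{i=1}^N\bigl(Z^{(N)}_i(t_2)-Z^{(N)}_i(t_1)-\mathrm E[Z^{(N)}_i(t_2)-Z^{(N)}_i(t_1)]\bigr)\Bigr|=0\quad\text{almost surely.}$$
   Context: $T>0$ is fixed and $\Delta=\{(t_1,t_2)\in\mathbb R^2\mid 0\le t_1\le t_2\le T\}$. $D_{\uparrow}=D_{\uparrow}([0,T],\mathbb R)$ is the set of non-decreasing, right continuous functions $y$ on the closed interval $[0,T]$ with left limits $y(t-0):=\lim_{s\uparrow t}y(s)$. $(\Omega,\mathcal F,\mathrm P)$ is a probability space on which all random variables (for all $N$) are defined. Independence is only assumed among $i=1,\ldots,N$ for each fixed $N$; nothing is assumed about dependence or independence between variables with different $N$. $\mathbb N$ is the set of positive integers. *)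

(* Defs.v *)
From HB Require Import structures.
From mathcomp Require Import all_boot all_order all_algebra.
From mathcomp Require Import all_classical all_reals all_analysis.

Set Implicit Arguments.
Unset Strict Implicit.
Unset Printing Implicit Defensive.

Import Order.TTheory GRing.Theory Num.Theory.
Import numFieldNormedType.Exports.

Local Open Scope classical_set_scope.
Local Open Scope ring_scope.

Definition Delta (R : realType) (T : R) : set (R * R) :=
  [set t | [/\ 0 <= t.1, t.1 <= t.2 & t.2 <= T]].

(* A function on [0, T] is represented by its extension by 0 to the whole line
   (Dup_out), so that elements of [Dup T] correspond one to one to functions on
   [0, T]. Right continuity is required on [0, T[ and left limits on ]0, T]:
   these are the points where the one-sided limit is taken inside [0, T]. *)
Record Dup (R : realType) (T : R) := MkDup {
  Dup_fun :> R -> R ;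
  Dup_nondecreasing : {in `[0, T] &, nondecreasing_fun Dup_fun} ;
  Dup_right_cts : {in `[0, T[, forall t, Dup_fun x @[x --> t^'+] --> Dup_fun t} ;
  Dup_left_lim : {in `]0, T], forall t, cvg (Dup_fun x @[x --> t^'-])} ;
  Dup_out : forall t, t \notin `[0, T] -> Dup_fun t = 0 }.

Section Dup_measurable.
Variables (R : realType) (T : R).

Let zero_Dup : Dup T.
Proof.
apply: (@MkDup R T (fun=> 0)) => //.
- by move=> t _; exact: cvg_cst.
- by move=> t _; exact: is_cvg_cst.
Qed.

HB.instance Definition _ := gen_eqMixin (Dup T).
HB.instance Definition _ := gen_choiceMixin (Dup T).
HB.instance Definition _ := isPointed.Build (Dup T) zero_Dup.

(* The sigma-algebra on D_up generated by the coordinates y |-> y t, 0 <= t <= T;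
   it coincides with the Borel sigma-algebra of the Skorokhod topology. *)
Definition Dup_coordinates : set (set (Dup T)) :=
  \bigcup_(t in `[0, T])
    preimage_set_system setT (fun y : Dup T => y t) (@measurable _ R).

Definition Dup_display : measure_display.
Proof. by constructor. Qed.

HB.instance Definition _ := @isMeasurable.Build Dup_display (Dup T)
  <<s Dup_coordinates >> (@sigma_algebra0 _ setT Dup_coordinates)
  (@sigma_algebraC (Dup T) Dup_coordinates)
  (@sigma_algebra_bigcup _ setT Dup_coordinates).

End Dup_measurable.

Definition independent_RVs d d' (Omega : measurableType d)
    (E : measurableType d') (R : realType) (P : probability Omega R)
    (I : finType) (X : I -> {RV P >-> E}) : Prop :=
  forall (J : {set I}) (A : I -> set E), (forall i, measurable (A i)) ->
    P (\bigcap_(i in [set i | i \in J]) (X i @^-1` A i)) =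
    (\prod_(i in J) P (X i @^-1` A i))%E.

Definition smallest_positive (p : nat -> Prop) (n : nat) : Prop :=
  [/\ (0 < n)%N, p n & forall m, (0 < m)%N -> p m -> (n <= m)%N].

(* Main.v *)
Require Import Defs.
From HB Require Import structures.
From mathcomp Require Import all_boot all_order all_algebra.
From mathcomp Require Import all_classical all_reals all_analysis.
From mathcomp Require Import measurable_realfun.
From mathcomp Require Import ring lra.

Set Implicit Arguments.
Unset Strict Implicit.
Unset Printing Implicit Defensive.

Import Order.TTheory GRing.Theory Num.Theory.
Import numFieldNormedType.Exports.

Local Open Scope classical_set_scope.
Local Open Scope ring_scope.

(** Let [Y] be the average of the [N] paths, [F] its mean and [G = Y - F]. The
supremum of [|G t - G s|] over a continuum of pairs is controlled by finitely
many values of [G]. Cut [[0, T]] into [m] equal cells on which [F] grows by at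
most [e]. Since [Y] is nondecreasing, inside a cell [G] lies between its values
at the two ends up to an error [e]; hence, with [s_j] the grid points, every
[|G t - G s|^q] is at most a constant depending on [q] times
[\sum_j |G s_j - G 0|^q + e^q] ([increment_sup_bound]). This sum is a
measurable random variable, and its expectation bounds that of the supremum.

Each [G s_j - G 0] is an average of [N] independent centred variables whose
moments of order [q] are of order [M^q], so its own moment is of order
[M^q N^(-q/2)] by an inequality of Marcinkiewicz-Zygmund type
([independent_sum_moment]). That inequality is obtained by adding one variable
[x] at a time to a partial sum [s]. The bound
[|s + x|^q <= |s|^q + q s |s|^(q-2) x + C (|s|^(q-2) x^2 + |x|^q)] has a linear
term of mean zero, and after [k] steps the remaining terms multiply the moment
by [1 + 1/(2k)] and add a multiple of [k^(q/2-1)], which the growth of [k^(q/2)]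
absorbs. Integrating in [x] for fixed [s] requires the joint law of a partial
sum and the next variable to be a product ([partial_sum_independent],
[ge0_integral_independent]).

It remains to choose the mesh. With [D = 2qr + 2r + 2] and
[e = M N^(-qr/D)], the Hoelder bound on [F] allows a number of cells of order
[T wbar^(1/r) N^(q/D) + 1], and both [m N^(-q/2)] and [(e/M)^q] are then at most
of order [N^(-q^2 r/D)] ([mesh_size], [average_dominated]). The condition
[(q^2 - 2q - 2) r > 2] says that [q^2 r/D > 1]: the expectations of the
dominating variables are then summable in [N], so that these variables, and the
suprema below them, tend to [0] almost surely
([ae_cvg0_of_summable_integral]). *)

(** * Inequalities for real powers *)

(** Inverting [1 - u <= expR (- u)] gives [expR u <= 1 / (1 - u)], which for
[u <= 1/2] is below the quadratic. *)
Lemma expR_le_quadratic (R : realType) (u : R) :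
  u <= 2^-1 -> expR u <= 1 + u + 2 * u ^+ 2.
Proof.
move=> u2; have := expR_ge1Dx (- u); rewrite expRN => h.
have e0 := expR_gt0 u.
have {}h : (1 - u) * expR u <= 1.
  by have := ler_wpM2r (ltW e0) h; rewrite mulVf// gt_eqF.
have : (1 - u) * expR u <= (1 - u) * (1 + u + 2 * u ^+ 2).
  apply: (le_trans h); nra.
by rewrite ler_pM2l//; lra.
Qed.

(** The first summand serves the large relative increments in
[powR1D_le_taylor], the second one the small ones. *)
Definition taylor_const (R : realType) (q : R) : R :=
  (2 * q + 1) `^ q + 2 * q ^+ 2.

(** If [|x| <= 1 / (2q)] then [(1 + x)^q <= expR (q x)] and the quadratic bound
on the exponential applies. Otherwise [|1 + x| <= (2q + 1) |x|], so that the
term in [|x|^q] dominates by itself, while [1 + y + 2 y^2 >= 0] for [y = q x]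
disposes of the linear term. *)
Lemma powR1D_le_taylor (R : realType) (q x : R) : 1 <= q ->
  `|1 + x| `^ q <= 1 + q * x +
    taylor_const q * (x ^+ 2 + `|x| `^ q).
Proof.
move=> q1; rewrite /taylor_const.
have c0 : 0 <= (2 * q + 1) `^ q by exact: powR_ge0.
have y0 : 0 <= `|x| `^ q by exact: powR_ge0.
have x0 : 0 <= x ^+ 2 by exact: sqr_ge0.
have q0 : 0 < q by lra.
have [xq|xq] := leP (`|x| * (2 * q)) 1.
  have qx : q * x <= 2^-1 by have := ler_norm x; nra.
  have x1 : 0 <= 1 + x.
    by have := lerNnormlW (lexx `|x|); nra.
  apply: (@le_trans _ _ (expR (q * x))).
    rewrite mulrC expRM ger0_norm// ge0_ler_powR ?nnegrE//; first lra.
    exact: expR_ge1Dx.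
  apply: (le_trans (expR_le_quadratic qx)); nra.
apply: (@le_trans _ _ ((2 * q + 1) `^ q * `|x| `^ q)).
  rewrite -powRM//; last lra.
  apply: ge0_ler_powR; rewrite ?nnegrE//; first lra.
    by apply: mulr_ge0 => //; lra.
  by rewrite (le_trans (ler_normD _ _))// normr1; nra.
have : 0 <= 1 + q * x + 2 * q ^+ 2 * x ^+ 2.
  have -> : 1 + q * x + 2 * q ^+ 2 * x ^+ 2 = 1 + q * x + 2 * (q * x) ^+ 2.
    by ring.
  nra.
nra.
Qed.

Lemma powR_subn2 (R : realType) (q s : R) : 0 < s ->
  s `^ q = s ^+ 2 * s `^ (q - 2).
Proof.
move=> s0; rewrite -powR_mulrn ?ltW// -powRD.
  by congr (_ `^ _); ring.
by rewrite lt0r_neq0 ?implybT.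
Qed.

(** [powR1D_le_taylor] at [b / a], multiplied by [|a|^q]. The linear term is
kept apart because it vanishes in the mean when [b] is centred. *)
Lemma powRD_le_taylor (R : realType) (q a b : R) : 2 < q ->
  `|a + b| `^ q <= `|a| `^ q + q * a * `|a| `^ (q - 2) * b +
    taylor_const q * (`|a| `^ (q - 2) * b ^+ 2 + `|b| `^ q).
Proof.
move=> q2; have [->|a0] := eqVneq a 0.
  rewrite add0r normr0 !powR0 ?gt_eqF//; try lra.
  rewrite /taylor_const mulr0 !mul0r !add0r ler_peMl ?powR_ge0//.
  have : 1 `^ q <= (2 * q + 1) `^ q.
    by apply: ge0_ler_powR; rewrite ?nnegrE//; lra.
  by rewrite powR1; nra.
have an : 0 < `|a| by rewrite normr_gt0.
have aq : `|a| `^ q = a ^+ 2 * `|a| `^ (q - 2).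
  by rewrite powR_subn2// real_normK ?num_real.
have b_E : b = a * (b / a) by rewrite mulrC divfK.
move: b_E; move: (b / a) => x ->.
have -> : a + a * x = a * (1 + x) by ring.
rewrite !normrM !powRM//.
have := powR1D_le_taylor x (ltW (lt_trans (ltr1n _ 2) q2)).
rewrite -(ler_pM2l (powR_gt0 q an)) => /le_trans; apply.
rewrite aq exprMn le_eqVlt; apply/orP; left; apply/eqP; ring.
Qed.

(** Convexity of the power at the midpoint of [2a] and [2b]. *)
Lemma powRD_le_convex (R : realType) (q a b : R) : 1 <= q -> 0 <= a -> 0 <= b ->
  (a + b) `^ q <= 2 `^ (q - 1) * (a `^ q + b `^ q).
Proof.
move=> q1 a0 b0.
have h0 : 0 <= (2^-1 : R) by lra.
have h1 : (2^-1 : R) <= 1 by lra.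
have := @convex_powR R q q1 (Itv01 h0 h1) (2 * a) (2 * b).
rewrite !inE /= !in_itv /= !andbT !mulr_ge0// => /(_ isT isT) h.
have {h} : (2^-1 * (2 * a) + (1 - 2^-1) * (2 * b)) `^ q <=
    2^-1 * (2 * a) `^ q + (1 - 2^-1) * (2 * b) `^ q by exact: h.
have -> : 1 - 2^-1 = 2^-1 :> R by lra.
rewrite !mulrA !mulVf// !mul1r => /le_trans; apply.
rewrite !powRM// -mulrDr -mulrDr mulrA powRB ?pnatr_eq0 ?implybT// powRr1//.
by rewrite (mulrC _ 2^-1).
Qed.

(** Compare [s] with the level [l]. In the mean this bounds a moment of order
[q - 2] by the one of order [q], as Lyapunov's inequality would, with [l] left
to be tuned. *)
Lemma powR_le_interp (R : realType) (q l s : R) : 2 < q -> 0 < l -> 0 <= s ->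
  s `^ (q - 2) <= l ^- 2 * s `^ q + l `^ (q - 2).
Proof.
move=> q2 l0 s0; have [sl|ls] := leP s l.
  rewrite (@le_trans _ _ (l `^ (q - 2)))//.
    by rewrite ge0_ler_powR ?nnegrE//; lra.
  by rewrite lerDr mulr_ge0 ?powR_ge0// invr_ge0 exprn_ge0// ltW.
have s_gt0 : 0 < s by lra.
rewrite (@le_trans _ _ (l ^- 2 * s `^ q)) ?lerDl ?powR_ge0//.
rewrite (@powR_subn2 _ q)// mulrA ler_peMl ?powR_ge0//.
by rewrite mulrC ler_pdivlMr ?exprn_gt0// mul1r lerXn2r ?nnegrE// ltW.
Qed.

Lemma powR_ge1 (R : realType) (x p : R) : 1 <= x -> 0 <= p -> 1 <= x `^ p.
Proof. by move=> x1 p0; have := ler_powR x1 p0; rewrite powRr0. Qed.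

Lemma taylor_const_ge1 (R : realType) (q : R) : 1 <= q -> 1 <= taylor_const q.
Proof.
move=> q1; rewrite /taylor_const.
have : 1 <= (2 * q + 1) `^ q by apply: powR_ge1; lra.
have := sqr_ge0 q; lra.
Qed.

(** * Joint laws and independence of partial sums *)

Section joint_law.
Context d d1 d2 (Omega : measurableType d) (T1 : measurableType d1)
  (T2 : measurableType d2) (R : realType) (P : probability Omega R).
Local Open Scope ereal_scope.

(** Both sides are finite measures in [C] that agree on rectangles. The event
[G] will be a constraint on further variables; carrying it along is what lets
independence pass from the variables to their partial sums. *)
Lemma joint_law_on_event (U : {mfun Omega >-> T1}) (V : {mfun Omega >-> T2})
    (G : set Omega) (mG : measurable G) :
  (forall A B, measurable A -> measurable B ->
     P (U @^-1` A `&` V @^-1` B `&` G) = P (U @^-1` A) * P (V @^-1` B) * P G) ->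
  forall C, measurable C ->
    P ((fun om => (U om, V om)) @^-1` C `&` G) =
    (distribution P U \x distribution P V) C * P G.
Proof.
move=> indep C mC.
have mUV : measurable_fun [set: Omega] (fun om => (U om, V om)).
  by apply/measurable_fun_pairP; split; apply: measurable_funP.
have PGfin : P G \is a fin_num by exact: fin_num_measure.
pose UV : {mfun Omega >-> (T1 * T2)%type} :=
  HB.pack (fun om => (U om, V om)) (isMeasurableFun.Build _ _ _ _ _ mUV).
pose p : {nonneg R} := NngNum (fine_ge0 (measure_ge0 P G)).
have pE : p%:num%:E = P G by rewrite fineK.
(* The factor [P G] is moved into the second marginal, where uniqueness of
   product measures can see it. *)
pose m2 := mscale p (distribution P V).
have m2E : forall B, m2 B = P (V @^-1` B) * P G.
  by move=> B; rewrite /m2 /mscale /= pE muleC.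
have mE := @product_measure_unique _ _ T1 T2 R (distribution P U) m2
  (pushforward (mrestr P mG) UV).
transitivity ((distribution P U \x m2) C).
  apply/esym/mE => // A B mA mB.
  transitivity (P (U @^-1` A) * m2 B); last by [].
  by rewrite m2E muleA -indep.
rewrite /product_measure1 -ge0_integralZr//.
  by apply: eq_integral => x _; rewrite /= m2E.
exact: measurable_fun_xsection.
Qed.

End joint_law.

Section two_variables.
Context d d1 d2 (Omega : measurableType d) (T1 : measurableType d1)
  (T2 : measurableType d2) (R : realType) (P : probability Omega R).
Local Open Scope ereal_scope.

(** The joint law is a product, so Tonelli's theorem applies. *)
Lemma ge0_integral_independent (U : {mfun Omega >-> T1})
    (V : {mfun Omega >-> T2}) (f : T1 * T2 -> \bar R) :
  (forall A B, measurable A -> measurable B ->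
     P (U @^-1` A `&` V @^-1` B) = P (U @^-1` A) * P (V @^-1` B)) ->
  measurable_fun [set: T1 * T2] f -> (forall z, 0 <= f z) ->
  \int[P]_om f (U om, V om) =
  \int[distribution P U]_x \int[P]_om f (x, V om).
Proof.
move=> indep mf f0.
have mUV : measurable_fun [set: Omega] (fun om => (U om, V om)).
  by apply/measurable_fun_pairP; split; apply: measurable_funP.
transitivity (\int[distribution P U \x distribution P V]_z f z).
  rewrite (_ : \int[P]_om _ =
      \int[pushforward P (fun om => (U om, V om))]_z f z).
    apply: eq_measure_integral => C mC _.
    rewrite -[RHS]mule1 -(probability_setT P) /=.
    rewrite -(joint_law_on_event measurableT)// /pushforward ?setIT//.
    by move=> A B mA mB; rewrite setIT probability_setT mule1 indep.
  by rewrite ge0_integral_pushforward.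
rewrite fubini_tonelli1//; apply: eq_integral => x _.
rewrite /fubini_F ge0_integral_distribution//.
exact: measurableT_comp mf (measurable_pair1 _).
Qed.

End two_variables.

Section partial_sums.
Context d (Omega : measurableType d) (R : realType) (P : probability Omega R).
Local Open Scope ereal_scope.

(** The event is a set of values of the pair [(U, V)], whose law is a product
both on [G] and on the whole space; the two factorizations share the same
product law. *)
Lemma sum_independent_of_event (U V : {mfun Omega >-> R})
    (G : set Omega) (mG : measurable G) :
  (forall A B, measurable A -> measurable B ->
     P (U @^-1` A `&` V @^-1` B `&` G) = P (U @^-1` A) * P (V @^-1` B) * P G) ->
  (forall A B, measurable A -> measurable B ->
     P (U @^-1` A `&` V @^-1` B) = P (U @^-1` A) * P (V @^-1` B)) ->
  forall A, measurable A ->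
    P ((fun om => (U om + V om)%R) @^-1` A `&` G) =
    P ((fun om => (U om + V om)%R) @^-1` A) * P G.
Proof.
move=> indG indT A mA.
pose C := (fun z : R * R => (z.1 + z.2)%R) @^-1` A.
have mC : measurable C.
  by rewrite -[C]setTI; apply: measurable_funD.
transitivity ((distribution P U \x distribution P V) C * P G).
  exact: joint_law_on_event.
congr (_ * _); rewrite -[LHS]mule1 -(probability_setT P).
rewrite -(joint_law_on_event measurableT) ?setIT// => B D mB mD.
by rewrite setIT probability_setT mule1 indT.
Qed.

(** The product rule over the whole range gives that of every subfamily, by
taking [A i = setT] outside it. *)
Definition independent_seq (n : nat) (X : nat -> {mfun Omega >-> R}) :=
  forall A : nat -> set R, (forall i, measurable (A i)) ->
    P (\big[setI/setT]_(0 <= i < n) (X i @^-1` A i)) =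
    \prod_(0 <= i < n) P (X i @^-1` A i).

Lemma measurable_partial_sum (X : nat -> {mfun Omega >-> R}) k :
  measurable_fun [set: Omega] (fun om => \sum_(0 <= i < k) X i om)%R.
Proof. by apply: measurable_sum. Qed.

(** The invariant of the induction on [k]: the partial sum takes the place of
the variables that it has absorbed. *)
Definition independent_of_rest n (X : nat -> {mfun Omega >-> R}) k :=
  forall (B : set R) (A : nat -> set R),
  measurable B -> (forall i, measurable (A i)) ->
    P ((fun om => \sum_(0 <= i < k) X i om)%R @^-1` B `&`
       \big[setI/setT]_(k <= i < n) (X i @^-1` A i)) =
    P ((fun om => \sum_(0 <= i < k) X i om)%R @^-1` B) *
    \prod_(k <= i < n) P (X i @^-1` A i).

Lemma independent_of_rest_head n (X : nat -> {mfun Omega >-> R}) k :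
  (k < n)%N -> independent_of_rest n X k ->
  forall (D E : set R) (A : nat -> set R),
  measurable D -> measurable E -> (forall i, measurable (A i)) ->
    P ((fun om => \sum_(0 <= i < k) X i om)%R @^-1` D `&` X k @^-1` E `&`
       \big[setI/setT]_(k.+1 <= i < n) (X i @^-1` A i)) =
    P ((fun om => \sum_(0 <= i < k) X i om)%R @^-1` D) * P (X k @^-1` E) *
    \prod_(k.+1 <= i < n) P (X i @^-1` A i).
Proof.
move=> kn H D E A mD mE mA.
pose A' i := if i == k then E else A i.
have mA' i : measurable (A' i) by rewrite /A'; case: ifP.
have := H D A' mD mA'.
have A'E i : (k < i < n)%N -> A' i = A i.
  by move=> /andP[ki _]; rewrite /A' gtn_eqF.
rewrite 2!(big_ltn kn).
rewrite (@eq_big_nat _ _ _ k.+1 n _ (fun i => X i @^-1` A i)); last first.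
  by move=> i /A'E ->.
rewrite (@eq_big_nat _ _ _ k.+1 n _ (fun i => P (X i @^-1` A i))); last first.
  by move=> i /A'E ->.
by rewrite /A' eqxx setIA muleA.
Qed.

Lemma independent_of_rest_pair n (X : nat -> {mfun Omega >-> R}) k :
  (k < n)%N -> independent_of_rest n X k ->
  forall D E, measurable D -> measurable E ->
    P ((fun om => \sum_(0 <= i < k) X i om)%R @^-1` D `&` X k @^-1` E) =
    P ((fun om => \sum_(0 <= i < k) X i om)%R @^-1` D) * P (X k @^-1` E).
Proof.
move=> kn H D E mD mE.
have := independent_of_rest_head kn H mD mE (fun=> measurableT).
rewrite big1 ?setIT; last by move=> i _; rewrite preimage_setT.
rewrite big1 ?mule1// => i _.
by rewrite preimage_setT probability_setT.
Qed.

(** The event formed by the variables after [X k] plays the part of [G] in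
[sum_independent_of_event], so that absorbing [X k] preserves the invariant. *)
Lemma partial_sum_independent (n : nat) (X : nat -> {mfun Omega >-> R}) :
  independent_seq n X -> forall k, (k <= n)%N -> independent_of_rest n X k.
Proof.
move=> indX; elim=> [_ B A mB mA|k IH kn B A mB mA].
  have -> : (fun om => \sum_(0 <= i < 0) X i om)%R = cst 0%R.
    by apply/funext => om; rewrite big_geq.
  rewrite preimage_cst; case: ifPn => _.
    by rewrite setTI probability_setT mul1e indX.
  by rewrite set0I measure0 mul0e.
pose U : {mfun Omega >-> R} := HB.pack (fun om => \sum_(0 <= i < k) X i om)%R
  (isMeasurableFun.Build _ _ _ _ _ (measurable_partial_sum X k)).
have SE : (fun om => \sum_(0 <= i < k.+1) X i om)%R =
    (fun om => U om + X k om)%R.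
  by apply/funext => om; rewrite big_nat_recr.
set G := \big[setI/setT]_(_ <= i < n) _.
have mG : measurable G.
  apply: bigsetI_measurable => i _.
  by rewrite -[X in measurable X]setTI; exact: measurable_funP.
have {}IH := IH (ltnW kn).
have PG : P G = \prod_(k.+1 <= i < n) P (X i @^-1` A i).
  have := independent_of_rest_head kn IH measurableT measurableT mA.
  by rewrite !preimage_setT !setTI probability_setT !mul1e.
rewrite -PG SE sum_independent_of_event//.
  move=> D E mD mE; rewrite PG.
  exact: (independent_of_rest_head kn IH mD mE mA).
by move=> D E mD mE; exact: (independent_of_rest_pair kn IH).
Qed.

End partial_sums.

(** * Moments of sums of independent centred variables *)

Section monotone.
Context d (T : measurableType d) (R : realType)
  (mu : {measure set T -> \bar R}).
Local Open Scope ereal_scope.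

(** The integral of a nonnegative function is a supremum over the simple
functions below it, which makes it monotone on arbitrary functions. A supremum
over uncountably many times can thus be integrated without knowing that it is
measurable. *)
Lemma ge0_le_integral_nonmeasurable (f g : T -> \bar R) :
  (forall x, 0 <= f x) -> (forall x, f x <= g x) ->
  \int[mu]_x f x <= \int[mu]_x g x.
Proof.
move=> f0 fg; have g0 x : 0 <= g x by exact: le_trans (f0 x) (fg x).
rewrite !ge0_integralTE//; apply: le_ereal_sup => _ [h hf <-]; exists h => //.
by move=> x; exact: le_trans (hf x) (fg x).
Qed.

End monotone.

Section moment_step.
Context d (Omega : measurableType d) (R : realType) (P : probability Omega R).
Context (q : R) (q2 : 2 < q).
Local Notation C := (taylor_const q).

Lemma measurable_powR_norm (f : Omega -> R) : measurable_fun setT f ->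
  measurable_fun setT (fun om => `|f om| `^ q).
Proof.
move=> mf; apply: (measurableT_comp (measurable_powR q)).
exact: measurableT_comp.
Qed.

Lemma sqr_le_1Dpow (v : R) : v ^+ 2 <= 1 + `|v| `^ q.
Proof.
have := @powR_ge0 R `|v| q; rewrite -real_normK ?num_real//.
have [v1|v1] := leP `|v| 1; first by have := normr_ge0 v; nra.
move=> _; apply: (@le_trans _ _ (`|v| `^ q)); last by rewrite lerDr.
by rewrite -powR_mulrn// ler_powR ?ltW.
Qed.

Lemma integrable_powR_norm (V : {mfun Omega >-> R}) (b : R) :
  (\int[P]_om (`|V om| `^ q)%:E <= b%:E)%E ->
  P.-integrable setT (fun om => (`|V om| `^ q)%:E).
Proof.
move=> Vq; apply/integrableP; split.
  by apply/measurable_EFinP; apply: measurable_powR_norm.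
under eq_integral do rewrite /= ger0_norm ?powR_ge0//.
by rewrite (le_lt_trans Vq)// ltry.
Qed.

(** In [powRD_le_taylor] at [(s, V)] the linear term integrates to zero, and the
square of [V] is bounded by means of [sqr_le_1Dpow]. *)
Lemma moment_translate (V : {mfun Omega >-> R}) (s : R) :
  (\int[P]_om (`|V om| `^ q)%:E <= 1)%E ->
  P.-integrable setT (EFin \o V) ->
  (\int[P]_om (V om)%:E = 0)%E ->
  (\int[P]_om (`|s + V om| `^ q)%:E <=
     (`|s| `^ q + C * (2 * `|s| `^ (q - 2) + 1))%:E)%E.
Proof.
move=> Vq iV V0.
have C0 : 0 <= C by rewrite addr_ge0 ?powR_ge0// mulr_ge0// sqr_ge0.
set a := `|s| `^ (q - 2); have a0 : 0 <= a by exact: powR_ge0.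
pose c0 := `|s| `^ q + C * a; pose c1 := q * s * a; pose c2 := C * (a + 1).
have c20 : 0 <= c2 by rewrite mulr_ge0// addr_ge0.
have iW := @integrable_powR_norm V 1 Vq.
apply: (@le_trans _ _ (\int[P]_om (c0%:E + (c1%:E * (V om)%:E +
    c2%:E * (`|V om| `^ q)%:E)))%E).
  apply: ge0_le_integral_nonmeasurable => om; rewrite lee_fin ?powR_ge0//.
  apply: (le_trans (powRD_le_taylor s (V om) q2)).
  rewrite -/a.
  have := sqr_le_1Dpow (V om); move: (`|V om| `^ q) => w vw.
  have : C * (a * V om ^+ 2) <= C * (a * (1 + w)) by rewrite !ler_wpM2l.
  by rewrite /c0 /c1 /c2; lra.
have ic : forall c : R, P.-integrable setT (fun=> c%:E).
  by move=> c; exact: finite_measure_integrable_cst.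
rewrite integralD//; last first.
  by apply: integrableD => //; exact: integrableZl.
rewrite integralD//; try exact: integrableZl.
rewrite !integralZl// V0 mule0 add0e integral_cst//.
rewrite [X in (_ * X + _)%E](probability_setT P) mule1.
apply: (@le_trans _ _ (c0%:E + c2%:E * 1)%E).
  by rewrite leeD2l// lee_wpmul2l// lee_fin.
by rewrite mule1 lee_fin /c0 /c2; lra.
Qed.

(** [moment_translate] integrated over the law of [U], the moment of order
[q - 2] being traded for the one of order [q] at the level [l]. *)
Lemma moment_step (U V : {mfun Omega >-> R}) (l : R) : 0 < l ->
  (forall A B, measurable A -> measurable B ->
     P (U @^-1` A `&` V @^-1` B) = P (U @^-1` A) * P (V @^-1` B))%E ->
  (\int[P]_om (`|V om| `^ q)%:E <= 1)%E ->
  P.-integrable setT (EFin \o V) ->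
  (\int[P]_om (V om)%:E = 0)%E ->
  (\int[P]_om (`|U om + V om| `^ q)%:E <=
     (1 + 2 * C / l ^+ 2)%:E * \int[P]_om (`|U om| `^ q)%:E +
     (C * (2 * l `^ (q - 2) + 1))%:E)%E.
Proof.
move=> l0 ind Vq iV V0.
have C0 : 0 <= C by rewrite addr_ge0 ?powR_ge0// mulr_ge0// sqr_ge0.
have k0 : 0 <= 1 + 2 * C / l ^+ 2.
  by rewrite addr_ge0// divr_ge0 ?sqr_ge0// mulr_ge0.
have d0 : 0 <= C * (2 * l `^ (q - 2) + 1).
  by rewrite mulr_ge0// addr_ge0// mulr_ge0// powR_ge0.
pose f (z : R * R) := (`|z.1 + z.2| `^ q)%:E.
have mf : measurable_fun [set: R * R] f.
  apply/measurable_EFinP; apply: (measurableT_comp (measurable_powR q)).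
  by apply: measurableT_comp => //; exact: measurable_funD.
have /= -> := @ge0_integral_independent _ _ _ _ _ _ _ P U V f ind mf
  (fun z => powR_ge0 _ _).
have mq : measurable_fun [set: R] (fun x : R => (`|x| `^ q)%:E).
  by apply/measurable_EFinP; exact: (measurableT_comp (measurable_powR q)).
rewrite -(@ge0_integral_distribution _ _ _ _ _ P U _ mq)//=.
rewrite -ge0_integralZl//.
have -> : (C * (2 * l `^ (q - 2) + 1))%:E =
    (\int[distribution P U]_x (C * (2 * l `^ (q - 2) + 1))%:E)%E.
  by rewrite integral_cst// [X in (_ * X)%E]probability_setT mule1.
rewrite -ge0_integralD//; last 2 first.
- by move=> x _; rewrite lee_fin mulr_ge0// powR_ge0.
- apply/measurable_EFinP; apply: measurable_funM => //.
  exact/measurable_EFinP.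
apply: ge0_le_integral_nonmeasurable => x.
  by apply: integral_ge0 => om _; rewrite lee_fin powR_ge0.
apply: (le_trans (moment_translate x Vq iV V0)).
rewrite -EFinM -EFinD lee_fin.
have := powR_le_interp q2 l0 (normr_ge0 x); move: (`|x| `^ (q - 2)) => y.
have C20 : 0 <= 2 * C by rewrite mulr_ge0.
by move=> /(ler_wpM2l C20); lra.
Qed.

End moment_step.

(** Twice the additive term of [moment_step] per unit of [k^(q/2-1)] when
[l^2 = 4 C k]; see [moment_const_step]. *)
Definition moment_const (R : realType) (q : R) : R :=
  2 * taylor_const q * (2 * (4 * taylor_const q) `^ (q / 2 - 1) + 1).

Lemma moment_const_ge1 (R : realType) (q : R) : 1 <= q -> 1 <= moment_const q.
Proof.
move=> q1; rewrite /moment_const; have := taylor_const_ge1 q1.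
have := powR_ge0 (4 * taylor_const q) (q / 2 - 1).
set x := _ `^ _; set y := taylor_const q; nra.
Qed.

(** At [l^2 = 4 C k] the factor of [moment_step] is [1 + 1/(2k)]. As [k^(q/2)]
increases by at least [k^(q/2-1)] from [k] to [k + 1], one half of that increase
pays for the factor and the other half for the additive term. *)
Lemma moment_const_step (R : realType) (q k : R) : 2 < q -> 1 <= k ->
  (1 + 2 * taylor_const q / (4 * taylor_const q * k)) *
      (moment_const q * k `^ (q / 2)) +
    taylor_const q * (2 * (4 * taylor_const q * k) `^ (q / 2 - 1) + 1) <=
  moment_const q * (k + 1) `^ (q / 2).
Proof.
move=> q2 k1; have C1 : 1 <= taylor_const q by apply: taylor_const_ge1; lra.
have A1 : 1 <= moment_const q by apply: moment_const_ge1; lra.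
have p0 : 0 < q / 2 by lra.
have kE : k `^ (q / 2) = k * k `^ (q / 2 - 1) by rewrite mulr_powRB1//; lra.
have k1E : (k + 1) `^ (q / 2) = (k + 1) * (k + 1) `^ (q / 2 - 1).
  by rewrite mulr_powRB1//; lra.
have yk : k `^ (q / 2 - 1) <= (k + 1) `^ (q / 2 - 1).
  by rewrite ge0_ler_powR ?nnegrE//; lra.
have y1 : 1 <= k `^ (q / 2 - 1).
  by apply: powR_ge1; lra.
have B0 := powR_ge0 (4 * taylor_const q) (q / 2 - 1).
have -> : 2 * taylor_const q / (4 * taylor_const q * k) = (2 * k)^-1.
  by field; rewrite !gt_eqF//; lra.
rewrite powRM; [|lra|lra].
rewrite kE k1E.
have AE : moment_const q =
  2 * taylor_const q * (2 * (4 * taylor_const q) `^ (q / 2 - 1) + 1) by [].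
move: AE B0 y1 yk A1 C1.
set B := (4 * taylor_const q) `^ _; set y := k `^ _; set y' := (k + 1) `^ _.
set C := taylor_const q; set A := moment_const q => AE B0 y1 yk A1 C1.
have -> : (1 + (2 * k)^-1) * (A * (k * y)) = A * (k * y) + A * y / 2.
  by field; rewrite gt_eqF//; lra.
have h1 : A * ((k + 1) * y) <= A * ((k + 1) * y').
  by rewrite !ler_wpM2l//; lra.
have h2 : C * (2 * (B * y) + 1) <= A * y / 2.
  rewrite AE; have : 0 <= C * (y - 1) by rewrite mulr_ge0//; lra.
  lra.
lra.
Qed.

Section moment_bound.
Context d (Omega : measurableType d) (R : realType) (P : probability Omega R).

(** A Marcinkiewicz-Zygmund type bound: the moment grows like [k^(q/2)], not
like the [k^q] of the triangle inequality. *)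
Lemma partial_sum_moment (q : R) (n : nat) (X : nat -> {mfun Omega >-> R}) :
  2 < q -> independent_seq P n X ->
  (forall i, (\int[P]_om (`|X i om| `^ q)%:E <= 1)%E) ->
  (forall i, P.-integrable setT (EFin \o X i)) ->
  (forall i, (\int[P]_om (X i om)%:E = 0)%E) ->
  forall k, (k <= n)%N ->
  (\int[P]_om (`|\sum_(0 <= i < k) X i om| `^ q)%:E <=
     (moment_const q * k%:R `^ (q / 2))%:E)%E.
Proof.
move=> q2 indX Xq iX X0; elim=> [_|k IH kn].
  have q0 : q != 0 by rewrite gt_eqF//; lra.
  under eq_integral do rewrite big_geq// normr0 powR0//.
  rewrite integral0 lee_fin mulr_ge0 ?powR_ge0//.
  by apply: le_trans ler01 (moment_const_ge1 _); lra.
have {}IH := IH (ltnW kn).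
under eq_integral do rewrite big_nat_recr//=.
(* The first summand is apart: the level [(4 C k)^(1/2)] is zero at [k = 0]. *)
case: k => [|k] in kn IH *.
  under eq_integral do rewrite big_geq// add0r.
  rewrite (le_trans (Xq _))// powR1 mulr1 lee_fin.
  by apply: moment_const_ge1; lra.
pose U : {mfun Omega >-> R} := HB.pack (fun om => \sum_(0 <= i < k.+1) X i om)%R
  (isMeasurableFun.Build _ _ _ _ _ (measurable_partial_sum X k.+1)).
have C1 : 1 <= taylor_const q by apply: taylor_const_ge1; lra.
have K1 : 1 <= k.+1%:R :> R by rewrite ler1n.
pose l2 := 4 * taylor_const q * k.+1%:R.
have l20 : 0 < l2 by rewrite !mulr_gt0//; lra.
pose l := l2 `^ 2^-1.
have l0 : 0 < l by exact: powR_gt0.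
have lE : l ^+ 2 = l2.
  by rewrite -powR_mulrn ?ltW// -powRrM mulVf// powRr1// ltW.
have lqE : l `^ (q - 2) = l2 `^ (q / 2 - 1).
  by rewrite -powRrM; congr (_ `^ _); field.
have := @moment_step _ _ _ P q q2 U (X k.+1) l l0
  (independent_of_rest_pair kn (partial_sum_independent indX (ltnW kn)))
  (Xq _) (iX _) (X0 _).
rewrite lE lqE => /le_trans; apply.
have c0 : 0 <= 1 + 2 * taylor_const q / l2.
  by rewrite addr_ge0// divr_ge0 ?mulr_ge0 ?ltW//; lra.
apply: (@le_trans _ _ ((1 + 2 * taylor_const q / l2)%:E *
   (moment_const q * k.+1%:R `^ (q / 2))%:E +
   (taylor_const q * (2 * l2 `^ (q / 2 - 1) + 1))%:E)%E).
  by rewrite leeD2r// lee_wpmul2l.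
rewrite -EFinM -EFinD lee_fin.
by rewrite -[in X in _ <= X]addn1 natrD; exact: moment_const_step.
Qed.

End moment_bound.

Section independent_families.
Context d (Omega : measurableType d) (R : realType) (P : probability Omega R).

Lemma independent_RVs_comp d1 d2 (E : measurableType d1)
    (E' : measurableType d2) (I : finType) (X : I -> {RV P >-> E})
    (Y : I -> {RV P >-> E'}) (g : I -> E -> E') :
  (forall i, measurable_fun setT (g i)) ->
  (forall i om, Y i om = g i (X i om)) ->
  independent_RVs X -> independent_RVs Y.
Proof.
move=> mg Yg indX J A mA.
have YE i : Y i @^-1` A i = X i @^-1` (g i @^-1` A i).
  by apply/seteqP; split=> om; rewrite /= Yg.
under eq_bigcapr do rewrite YE.
under eq_bigr do rewrite YE.
by apply: indX => i; rewrite -[X in measurable X]setTI; exact: mg.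
Qed.

(** Passing from ['I_n] to [nat] is what permits induction on the number of
summands. *)
Lemma independent_RVs_seq (n : nat) (V : 'I_n -> {RV P >-> R})
    (X : nat -> {mfun Omega >-> R}) :
  (forall i : 'I_n, X i = V i) -> independent_RVs V -> independent_seq P n X.
Proof.
move=> XV indV A mA; rewrite !big_mkord.
have := indV [set: 'I_n]%SET (fun i => A i) (fun i => mA i).
under eq_bigl do rewrite inE.
under [in X in _ = X -> _]eq_bigr do rewrite -XV.
move=> <-; congr (P _).
rewrite -(bigcap_mkord n (fun i => X i @^-1` A i)).
apply/seteqP; split=> om /=.
  by move=> h i _; rewrite /= -XV; apply: (h i) => /=.
move=> h i /= ni; rewrite (XV (Ordinal ni)).
by have := h (Ordinal ni); apply; rewrite /= inE.
Qed.

(** By homogeneity the case [b = 1] suffices. *)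
Lemma independent_sum_moment (q b : R) (n : nat) (U : 'I_n -> {RV P >-> R}) :
  2 < q -> 0 < b -> independent_RVs U ->
  (forall i, (\int[P]_om (`|U i om| `^ q)%:E <= b%:E)%E) ->
  (forall i, P.-integrable setT (EFin \o U i)) ->
  (forall i, (\int[P]_om (U i om)%:E = 0)%E) ->
  (\int[P]_om (`|\sum_(i < n) U i om| `^ q)%:E <=
     (moment_const q * n%:R `^ (q / 2) * b)%:E)%E.
Proof.
move=> q2 b0 indU Uq iU U0.
pose c := b `^ (- q^-1).
have c0 : 0 < c by exact: powR_gt0.
have cq : c `^ q = b^-1.
  by rewrite -powRrM mulNr mulVf ?gt_eqF ?powR_inv1 ?ltW//; lra.
have mV (i : 'I_n) : measurable_fun setT (fun om => c * U i om).
  exact: measurable_funM.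
pose V (i : 'I_n) : {RV P >-> R} := HB.pack (fun om => c * U i om)
  (isMeasurableFun.Build _ _ _ _ _ (mV i)).
(* The value beyond [n] is arbitrary, but it must be centred and of moment at
   most [1]. *)
pose X (k : nat) : {mfun Omega >-> R} :=
  if insub k is Some i then V i else cst 0.
have XV (i : 'I_n) : X i = V i by rewrite /X valK.
have indV : independent_RVs V.
  apply: (@independent_RVs_comp _ _ _ _ _ U V (fun _ x => c * x)) => // i.
  exact: measurable_funM.
have Vq i : (\int[P]_om (`|V i om| `^ q)%:E <= 1)%E.
  rewrite (_ : \int[P]_om _ = \int[P]_om ((b^-1)%:E * (`|U i om| `^ q)%:E))%E.
    rewrite ge0_integralZl ?lee_fin ?invr_ge0 ?(ltW b0)//.
      rewrite (le_trans (lee_wpmul2l _ (Uq i))) ?lee_fin ?invr_ge0 ?(ltW b0)//.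
      by rewrite mulVf// gt_eqF.
    by apply/measurable_EFinP; exact: measurable_powR_norm.
  apply: eq_integral => om _; rewrite -EFinM /= normrM powRM//.
  by rewrite (gtr0_norm c0) cq.
have iV i : P.-integrable setT (EFin \o V i).
  rewrite (_ : EFin \o V i = fun om => (c%:E * (EFin \o U i) om)%E)//.
  exact: integrableZl.
have V0 i : (\int[P]_om (V i om)%:E = 0)%E.
  rewrite (_ : \int[P]_om _ = \int[P]_om (c%:E * (U i om)%:E))%E//.
  by rewrite integralZl//; [rewrite [X in (_ * X)%E](U0 i) mule0|exact: iU].
have q0 : q != 0 by rewrite gt_eqF//; lra.
have := @partial_sum_moment _ _ _ P q n X q2 (independent_RVs_seq XV indV).
move=> /(_ _ _ _ n (leqnn n)) XM.
have {}XM : (\int[P]_om (`|\sum_(0 <= i < n) X i om| `^ q)%:E <=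
     (moment_const q * n%:R `^ (q / 2))%:E)%E.
  apply: XM => i; rewrite /X; case: insubP => [j _ _|_].
  - exact: Vq.
  - by under eq_integral do rewrite normr0 powR0//; rewrite integral0.
  - exact: iV.
  - exact: finite_measure_integrable_cst.
  - exact: V0.
  - by rewrite integral0.
rewrite (_ : \int[P]_om _ =
   \int[P]_om (b%:E * (`|\sum_(0 <= i < n) X i om| `^ q)%:E))%E.
  rewrite ge0_integralZl ?lee_fin ?(ltW b0)//; last first.
    apply/measurable_EFinP; apply: measurable_powR_norm.
    exact: measurable_partial_sum.
  by rewrite muleC EFinM lee_wpmul2r// lee_fin ltW.
apply: eq_integral => om _.
rewrite big_mkord [in RHS](eq_bigr (fun i : 'I_n => c * U i om)); last first.
  by move=> i _; rewrite XV.
rewrite -mulr_sumr normrM powRM// (gtr0_norm c0) cq -EFinM mulrA mulfV ?mul1r//.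
by rewrite gt_eqF.
Qed.

End independent_families.

Section centering.
Context d (Omega : measurableType d) (R : realType) (P : probability Omega R).

(** Since [+oo - +oo = -oo], the integral is finite only when those of the
positive and negative parts both are. *)
Lemma integral_fin_num_integrable (f : Omega -> R) :
  measurable_fun setT f -> (\int[P]_om (f om)%:E)%E \is a fin_num ->
  P.-integrable setT (EFin \o f).
Proof.
move=> mf; have mEf : measurable_fun setT (EFin \o f) by exact/measurable_EFinP.
rewrite (_ : (\int[P]_om (f om)%:E = \int[P]_om (EFin \o f) om)%E)// integralE.
rewrite fin_numB => /andP[fp fn].
apply/integrableP; split => //.
under eq_integral do rewrite -/((abse \o (EFin \o f)) _) fune_abse.
rewrite ge0_integralD//; last 2 first.
- exact: measurable_funepos.
- exact: measurable_funeneg.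
by rewrite lte_add_pinfty// -ge0_fin_numE// integral_ge0.
Qed.

(** This is [y <= 1 + y^q] at [y = |x| / b]. In the mean it yields
[2 b] as a bound for a first moment when the moment of order [q] is at most
[b^q], in place of Jensen's inequality. *)
Lemma norm_le_moment (q b x : R) : 1 <= q -> 0 < b ->
  `|x| <= b + b / b `^ q * `|x| `^ q.
Proof.
move=> q1 b0; have bq0 := powR_gt0 q b0; have xq0 := powR_ge0 `|x| q.
have [xb|bx] := leP `|x| b.
  by rewrite (le_trans xb)// lerDl mulr_ge0// divr_ge0 ?ltW.
apply: (@le_trans _ _ (b / b `^ q * `|x| `^ q)); last by rewrite lerDr ltW.
have -> : b / b `^ q * `|x| `^ q = b * (`|x| / b) `^ q.
  rewrite powRM ?invr_ge0 ?(ltW b0)//.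
  have -> : b^-1 `^ q = (b `^ q)^-1.
    by rewrite -powR_inv1 ?ltW// -powRrM mulN1r powRN.
  by rewrite mulrAC mulrA mulrAC.
have {1}-> : `|x| = b * (`|x| / b) by rewrite mulrC divfK// gt_eqF.
rewrite ler_pM2l//.
by apply: le1r_powR => //; rewrite ler_pdivlMr// mul1r ltW.
Qed.

(** The mean is at most [2 b] in absolute value by [norm_le_moment], and
[powRD_le_convex] separates it from the variable. *)
Lemma centered_moment (q b m : R) (U : {mfun Omega >-> R}) : 1 <= q -> 0 < b ->
  (\int[P]_om (`|U om| `^ q)%:E <= (b `^ q)%:E)%E ->
  (\int[P]_om (U om)%:E = m%:E)%E ->
  (\int[P]_om (`|U om - m| `^ q)%:E <=
     (2 `^ (q - 1) * (1 + 2 `^ q) * b `^ q)%:E)%E.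
Proof.
move=> q1 b0 Uq Um; have bq0 := powR_gt0 q b0.
have mU : measurable_fun setT (fun om => (`|U om| `^ q)%:E).
  by apply/measurable_EFinP; exact: measurable_powR_norm.
have mb : `|m| <= 2 * b.
  rewrite -lee_fin -[X in (X <= _)%E]/(`|m%:E|)%E -Um.
  apply: (le_trans (le_abse_integral _ _ _)) => //.
    exact/measurable_EFinP.
  apply: (@le_trans _ _ (\int[P]_om
      (b%:E + (b / b `^ q)%:E * (`|U om| `^ q)%:E))%E).
    apply: ge0_le_integral_nonmeasurable => om//=.
    by rewrite lee_fin norm_le_moment.
  have k0 : 0 <= b / b `^ q by rewrite divr_ge0 ?ltW.
  rewrite ge0_integralD//; last 3 first.
  - by move=> om _; rewrite lee_fin ltW.
  - by move=> om _; rewrite lee_fin mulr_ge0 ?powR_ge0.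
  - exact: measurable_funeM.
  rewrite integral_cst// [X in (_ * X + _)%E](probability_setT P) mule1.
  rewrite ge0_integralZl//.
  apply: (@le_trans _ _ (b%:E + (b / b `^ q)%:E * (b `^ q)%:E)%E).
    by rewrite leeD2l// lee_wpmul2l.
  by rewrite -EFinM -EFinD lee_fin divfK ?gt_eqF//; lra.
have c0 : 0 <= 2 `^ (q - 1) :> R by exact: powR_ge0.
apply: (@le_trans _ _ (\int[P]_om ((2 `^ (q - 1) * (2 * b) `^ q)%:E +
    (2 `^ (q - 1))%:E * (`|U om| `^ q)%:E))%E).
  apply: ge0_le_integral_nonmeasurable => om; first by rewrite lee_fin powR_ge0.
  rewrite -EFinM -EFinD lee_fin.
  apply: (@le_trans _ _ ((`|U om| + `|m|) `^ q)).
    by rewrite ge0_ler_powR ?nnegrE ?addr_ge0 ?ler_normB//; lra.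
  apply: (le_trans (powRD_le_convex q1 (normr_ge0 _) (normr_ge0 _))).
  rewrite -mulrDr ler_wpM2l// addrC lerD2r ge0_ler_powR ?nnegrE//; lra.
rewrite ge0_integralD//; last 2 first.
- by move=> om _; rewrite lee_fin mulr_ge0 ?powR_ge0.
- exact: measurable_funeM.
rewrite integral_cst// [X in (_ * X + _)%E](probability_setT P) mule1.
rewrite ge0_integralZl//.
apply: (@le_trans _ _ ((2 `^ (q - 1) * (2 * b) `^ q)%:E +
    (2 `^ (q - 1))%:E * (b `^ q)%:E)%E).
  by rewrite leeD2l// lee_wpmul2l.
rewrite -EFinM -EFinD lee_fin powRM ?(ltW b0)// le_eqVlt; apply/orP; left.
by apply/eqP; ring.
Qed.

End centering.

(** * Monotone functions on a grid *)

Section grid.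
Context (R : realType).

(** For [t] in the cell [[s_j, s_(j+1)]], monotonicity of [y] and the bound on
the growth of [f] give [g s_j - e <= g t <= g s_(j+1) + e]. The end to choose
depends on the sign of [g t - g 0]. *)
Lemma increment_grid_bound (T e : R) (m : nat) (y f : R -> R) :
  0 < T -> (0 < m)%N -> 0 <= e ->
  {in `[0, T] &, nondecreasing_fun y} ->
  (forall s t, s \in `[0, T] -> t \in `[0, T] -> s <= t -> t - s <= T / m%:R ->
     f t - f s <= e) ->
  let g t := y t - f t in
  forall t, t \in `[0, T] ->
  exists2 j : nat, (j <= m)%N &
    `|g t - g 0| <= `|g (j%:R * (T / m%:R)) - g 0| + e.
Proof.
move=> T0 m0 e0 ynd fe g t tT.
have mR : 0 < m%:R :> R by rewrite ltr0n.
have h0 : 0 < T / m%:R by exact: divr_gt0.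
set h := T / m%:R in fe h0 *.
have Th : T = m%:R * h by rewrite /h mulrC divfK// gt_eqF.
have sj j : (j <= m)%N -> j%:R * h \in `[0, T].
  move=> jm; rewrite in_itv/= mulr_ge0 ?ler0n ?(ltW h0)//= Th.
  by rewrite ler_wpM2r ?(ltW h0)// ler_nat.
move: (tT); rewrite in_itv/= => /andP[t0 tleT].
have [tltT|Tt] := ltP t T; last first.
  exists m => //; have -> : m%:R * h = t.
    by rewrite -Th; apply/eqP; rewrite eq_le Tt tleT.
  by rewrite lerDl.
pose j := Num.truncn (t / h).
have /truncn_itv : 0 <= t / h by rewrite divr_ge0// ltW.
rewrite -/j ler_pdivlMr// ltr_pdivrMr// => /andP[jt tj].
have jm : (j < m)%N.
  by rewrite -(ltr_nat R) -(ltr_pM2r h0) -Th (le_lt_trans jt).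
have s1 := sj _ (ltnW jm); have s2 := sj _ jm.
have jS : j.+1%:R * h - j%:R * h = h.
  by rewrite -addn1 natrD mulrDl mul1r addrAC subrr add0r.
have y1 := ynd _ _ s1 tT jt; have y2 := ynd _ _ tT s2 (ltW tj).
have f1 : f t - f (j%:R * h) <= e by apply: fe => //; lra.
have f2 : f (j.+1%:R * h) - f t <= e by apply: fe => //; lra.
have [gt|gt] := leP (g 0) (g t).
  exists j.+1 => //; rewrite ger0_norm; last lra.
  by have := ler_norm (g (j.+1%:R * h) - g 0); rewrite /g in gt *; lra.
exists j; first exact: ltnW.
rewrite ltr0_norm; last lra.
by have := ler_norm (- (g (j%:R * h) - g 0)); rewrite normrN /g in gt *; lra.
Qed.

(** Going through the origin, [g t - g s = (g t - g 0) - (g s - g 0)], leaves a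
sum over grid points instead of pairs of them, and hence a bound linear in the
number of cells. *)
Lemma increment_sup_bound (q T e : R) (m : nat) (y f : R -> R) :
  1 <= q -> 0 < T -> (0 < m)%N -> 0 <= e ->
  {in `[0, T] &, nondecreasing_fun y} ->
  (forall s t, s \in `[0, T] -> t \in `[0, T] -> s <= t -> t - s <= T / m%:R ->
     f t - f s <= e) ->
  let g t := y t - f t in
  forall s t, s \in `[0, T] -> t \in `[0, T] ->
  `|g t - g s| `^ q <= 2 `^ (q - 1) * 2 `^ q *
     (\sum_(j < m) `|g (j.+1%:R * (T / m%:R)) - g 0| `^ q + e `^ q).
Proof.
move=> q1 T0 m0 e0 ynd fe g s t sT tT.
set S := \sum_(j < m) _.
have S0 : 0 <= S by apply: sumr_ge0 => j _; exact: powR_ge0.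
have q0 : 0 <= q by lra.
have key u : u \in `[0, T] -> `|g u - g 0| `^ q <= 2 `^ (q - 1) * (S + e `^ q).
  move=> uT; have [j jm gj] := increment_grid_bound T0 m0 e0 ynd fe uT.
  apply: (@le_trans _ _ ((`|g (j%:R * (T / m%:R)) - g 0| + e) `^ q)).
    by rewrite ge0_ler_powR ?nnegrE ?addr_ge0.
  apply: (le_trans (powRD_le_convex q1 (normr_ge0 _) e0)).
  rewrite ler_wpM2l ?powR_ge0// lerD2r.
  (* The grid point [0] contributes nothing, so the sum starts at the next. *)
  case: j jm {gj} => [_|j jm].
    by rewrite mul0r subrr normr0 powR0//; lra.
  rewrite /S (bigD1 (Ordinal jm))//= lerDl.
  by apply: sumr_ge0 => i _; exact: powR_ge0.
apply: (@le_trans _ _ ((`|g t - g 0| + `|g s - g 0|) `^ q)).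
  rewrite ge0_ler_powR ?nnegrE ?addr_ge0//.
  by rewrite (distrC (g s)) (le_trans _ (ler_normD _ _))// addrA subrK.
apply: (le_trans (powRD_le_convex q1 (normr_ge0 _) (normr_ge0 _))).
rewrite -mulrA ler_wpM2l ?powR_ge0//.
have -> : 2 `^ q = 2 * 2 `^ (q - 1) :> R by rewrite mulr_powRB1//; lra.
by have := key _ sT; have := key _ tT; lra.
Qed.

End grid.

Section mesh.
Context (R : realType).

(** With [D = 2qr + 2r + 2], take for [m] the integer just above
[T W^(1/r) n^(q/D)]. The first bound makes the growth per cell small; the second
one is the number of cells times the moment at a grid point, and holds because
[q/D - q/2 <= - q^2 r/D]. *)
Lemma mesh_size (q r T W n : R) : 0 < q -> 0 < r -> 0 < T -> 0 <= W -> 1 <= n ->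
  exists m : nat, [/\ (0 < m)%N,
    W * (T / m%:R) `^ r <= n `^ (- (q * r / (2 * q * r + 2 * r + 2))) &
    m%:R * n `^ (- (q / 2)) <=
      (T * W `^ r^-1 + 1) * n `^ (- (q ^+ 2 * r / (2 * q * r + 2 * r + 2)))].
Proof.
move=> q0 r0 T0 W0 n1; set D := 2 * q * r + 2 * r + 2.
have qr0 : 0 < q * r by exact: mulr_gt0.
have D0 : 0 < D by rewrite /D; lra.
have n0 : 0 < n by lra.
pose x := T * W `^ r^-1 * n `^ (q / D).
have x0 : 0 <= x by rewrite !mulr_ge0 ?powR_ge0// ltW.
have /truncn_itv/andP[mx xm] := x0.
exists (Num.truncn x).+1; set m := (Num.truncn x).+1.
have m0 : 0 < m%:R :> R by rewrite ltr0n.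
split => //.
  have xr : x `^ r = T `^ r * W * n `^ (q * r / D).
    rewrite /x !powRM ?mulr_ge0 ?powR_ge0 ?(ltW T0)// -!powRrM mulVf ?gt_eqF//.
    by rewrite powRr1//; congr (_ * _ `^ _); rewrite mulrAC.
  have xmr : x `^ r <= m%:R `^ r by rewrite ge0_ler_powR ?nnegrE// ltW.
  rewrite powRN -[leRHS]div1r ler_pdivlMr ?powR_gt0//.
  rewrite powRM ?invr_ge0 ?(ltW T0) ?(ltW m0)//.
  have -> : (m%:R : R)^-1 `^ r = (m%:R `^ r)^-1.
    by rewrite -powR_inv1 ?ltW// -powRrM mulN1r powRN.
  rewrite mulrA mulrAC ler_pdivrMr ?powR_gt0// mul1r (le_trans _ xmr)// xr.
  by rewrite [W * _]mulrC.
have c1 : 1 <= n `^ (q / D) by apply: powR_ge1 => //; rewrite divr_ge0 ?ltW.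
have mle : m%:R <= (T * W `^ r^-1 + 1) * n `^ (q / D).
  by rewrite mulrDl mul1r -/x /m -addn1 natrD; apply: lerD.
apply: (@le_trans _ _ ((T * W `^ r^-1 + 1) * n `^ (q / D) * n `^ (- (q / 2)))).
  by rewrite ler_wpM2r ?powR_ge0.
rewrite -mulrA; apply: ler_wpM2l.
  by rewrite addr_ge0 ?mulr_ge0 ?powR_ge0 ?(ltW T0).
rewrite -powRD; last by rewrite (gt_eqF n0) implybT.
apply: ler_powR => //.
rewrite -subr_ge0.
have -> : - (q ^+ 2 * r / D) - (q / D - q / 2) = q * r / D.
  by rewrite /D; field; rewrite gt_eqF// -/D.
by rewrite divr_ge0 ?ltW.
Qed.

End mesh.

(** * Averages of independent monotone processes *)

Section evaluation.
Context (R : realType) (T : R).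

Lemma measurable_Dup_eval (t : R) : t \in `[0, T] ->
  measurable_fun [set: Dup T] (fun y : Dup T => y t).
Proof.
move=> tT _ B mB; apply: sub_sigma_algebra.
by exists t => //; exists B.
Qed.

End evaluation.

(** The factor [2^q] is that of [increment_sup_bound]; the others bound the
moment of a sum and the effect of centring. The root makes it the constant
whose power of order [q] enters the estimate. *)
Definition increment_const (R : realType) (q : R) : R :=
  (2 `^ q * (moment_const q * (2 `^ (q - 1) * (1 + 2 `^ q)))) `^ q^-1.

Section processes.
Context (R : realType) (q T r : R) (d : measure_display)
  (Omega : measurableType d) (P : probability Omega R) (N : nat)
  (Z : 'I_N -> {RV P >-> Dup T}) (M : R) (w : 'I_N -> R).
Context (q2 : 2 < q) (T0 : 0 < T) (r0 : 0 < r) (N0 : (0 < N)%N) (M0 : 0 < M)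
  (w0 : forall i, 0 <= w i) (indZ : independent_RVs Z)
  (hi : forall i,
    ('E_P[fun om => (`|Z i om T - Z i om 0| `^ q)%R] `^ q^-1 <= M%:E)%E)
  (hii : forall i (s t : R), s \in `[0, T] -> t \in `[0, T] ->
    (`|'E_P[fun om => Z i om t] - 'E_P[fun om => Z i om s]|
         <= (M * w i * `|t - s| `^ r)%:E)%E).

Definition mean_path (i : 'I_N) (t : R) : R := fine 'E_P[fun om => Z i om t]%E.

Definition average (om : Omega) (t : R) : R := N%:R^-1 * \sum_(i < N) Z i om t.

Definition mean_average (t : R) : R := N%:R^-1 * \sum_(i < N) mean_path i t.

Let zero_in : 0 \in `[0, T].
Proof. by rewrite in_itv/= lexx ltW. Qed.

Let T_in : T \in `[0, T].
Proof. by rewrite in_itv/= lexx ltW. Qed.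

Let NR0 : 0 < N%:R :> R.
Proof. by rewrite ltr0n. Qed.

Lemma measurable_eval i t : t \in `[0, T] ->
  measurable_fun setT (fun om => Z i om t).
Proof.
by move=> tT; apply: (measurableT_comp (measurable_Dup_eval tT)).
Qed.

(** The Hoelder hypothesis at [s = t] excludes infinite expectations, whose
difference would be [-oo]. *)
Lemma mean_pathE i t : t \in `[0, T] ->
  (\int[P]_om (Z i om t)%:E = (mean_path i t)%:E)%E.
Proof.
move=> tT; rewrite /mean_path fineK; first by rewrite unlock.
by have := hii i tT tT; case: ('E_P[_])%E.
Qed.

Lemma integrable_eval i t : t \in `[0, T] ->
  P.-integrable setT (EFin \o (fun om => Z i om t)).
Proof.
move=> tT; apply: integral_fin_num_integrable; first exact: measurable_eval.
by rewrite mean_pathE.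
Qed.

Lemma integrable_increment i (s t : R) : s \in `[0, T] -> t \in `[0, T] ->
  P.-integrable setT (fun om => (Z i om t - Z i om s)%:E).
Proof.
move=> sT tT.
rewrite (_ : (fun _ => _) = (EFin \o (fun om => Z i om t)) \-
  (EFin \o (fun om => Z i om s)))%E//.
by apply: integrableB => //; exact: integrable_eval.
Qed.

Lemma integral_increment i (s t : R) : s \in `[0, T] -> t \in `[0, T] ->
  (\int[P]_om (Z i om t - Z i om s)%:E = (mean_path i t - mean_path i s)%:E)%E.
Proof.
move=> sT tT.
rewrite EFinB -!mean_pathE// -integralB_EFin//; exact: integrable_eval.
Qed.

Lemma expectation_increment i (s t : R) : s \in `[0, T] -> t \in `[0, T] ->
  ('E_P[fun om => (Z i om t - Z i om s)%R] =
   (mean_path i t - mean_path i s)%:E)%E.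
Proof. by move=> sT tT; rewrite unlock integral_increment. Qed.

Lemma expectation_average_increment (s t : R) :
  s \in `[0, T] -> t \in `[0, T] ->
  ('E_P[fun om => (average om t - average om s)%R] =
   (mean_average t - mean_average s)%:E)%E.
Proof.
move=> sT tT; rewrite unlock /average /mean_average.
rewrite (_ : \int[P]_om _ = \int[P]_om ((N%:R^-1)%:E *
   \sum_(i < N) (Z i om t - Z i om s)%:E))%E; last first.
  apply: eq_integral => om _.
  by rewrite sumEFin -EFinM sumrB mulrBr.
rewrite integralZl//; last first.
  by apply: integrable_sum => //= i _; exact: integrable_increment.
rewrite integral_sum//; last by move=> i; exact: integrable_increment.
under eq_bigr do rewrite integral_increment//.
by rewrite sumEFin -EFinM sumrB mulrBr.
Qed.

Lemma nondecreasing_average om : {in `[0, T] &, nondecreasing_fun (average om)}.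
Proof.
move=> s t sT tT st; rewrite ler_wpM2l ?invr_ge0//.
by apply: ler_sum => i _; exact: (Dup_nondecreasing (Z i om)).
Qed.

Lemma mean_average_modulus (s t : R) : s \in `[0, T] -> t \in `[0, T] ->
  mean_average t - mean_average s <=
  M * (N%:R^-1 * \sum_(i < N) w i) * `|t - s| `^ r.
Proof.
move=> sT tT; rewrite /mean_average -mulrBr -sumrB.
rewrite [M * _]mulrCA -mulrA ler_wpM2l ?invr_ge0// mulr_sumr mulr_suml.
apply: ler_sum => i _.
have := hii i sT tT.
have EE u : u \in `[0, T] -> ('E_P[fun om => Z i om u] = (mean_path i u)%:E)%E.
  by move=> uT; rewrite unlock mean_pathE.
rewrite !EE// lee_fin; exact/le_trans/ler_norm.
Qed.

(** Monotone paths: no increment from [0] exceeds the total one. *)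
Lemma increment_moment i t : t \in `[0, T] ->
  (\int[P]_om (`|Z i om t - Z i om 0| `^ q)%:E <= (M `^ q)%:E)%E.
Proof.
move=> tT; have q0 : 0 < q by exact: lt_trans q2.
apply: (@le_trans _ _ ('E_P[fun om => (`|Z i om T - Z i om 0| `^ q)%R])%E).
  rewrite unlock; apply: ge0_le_integral_nonmeasurable => om.
    by rewrite lee_fin powR_ge0.
  have nd := Dup_nondecreasing (Z i om).
  move: (tT); rewrite in_itv/= => /andP[t_ge0 t_leT].
  have h1 : Z i om 0 <= Z i om t by apply: nd.
  have h2 : Z i om t <= Z i om T by apply: nd.
  rewrite lee_fin ge0_ler_powR ?nnegrE ?(ltW q0)//.
  by rewrite !ger0_norm ?subr_ge0 ?(le_trans h1)// lerD2r.
have E0 : (0 <= 'E_P[fun om => (`|Z i om T - Z i om 0| `^ q)%R])%E.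
  by apply: expectation_ge0 => om; exact: powR_ge0.
rewrite -[leLHS]poweRe1// -(mulVf (lt0r_neq0 q0)) poweRrM -poweR_EFin.
apply: gt0_ler_poweR => //; rewrite ?in_itv/= ?leey ?lee_fin ?poweR_ge0//.
- exact: ltW.
- by rewrite (ltW M0).
Qed.

(** The factor [N^(-q)] of the average against the [N^(q/2)] of
[independent_sum_moment]. *)
Lemma average_moment t : t \in `[0, T] ->
  (\int[P]_om (`|(average om t - mean_average t) -
                 (average om 0 - mean_average 0)| `^ q)%:E <=
   (moment_const q * (2 `^ (q - 1) * (1 + 2 `^ q)) * M `^ q *
      N%:R `^ (- (q / 2)))%:E)%E.
Proof.
move=> tT; have q0 : 0 < q by exact: lt_trans q2.
have q1 : 1 <= q by rewrite ltW// (lt_trans _ q2)// ltr1n.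
pose m i := mean_path i t - mean_path i 0.
pose g i (y : Dup T) := y t - y 0 - m i.
have mg i : measurable_fun setT (g i).
  apply: measurable_funB => //.
  by apply: measurable_funB; exact: measurable_Dup_eval.
have mU i : measurable_fun setT (fun om => g i (Z i om)).
  exact: measurableT_comp (mg i) _.
pose U i : {RV P >-> R} := HB.pack (fun om => g i (Z i om))
  (isMeasurableFun.Build _ _ _ _ _ (mU i)).
have mV i : measurable_fun setT (fun om => Z i om t - Z i om 0).
  by apply: measurable_funB; exact: measurable_eval.
pose V i : {mfun Omega >-> R} := HB.pack (fun om => Z i om t - Z i om 0)
  (isMeasurableFun.Build _ _ _ _ _ (mV i)).
have indU : independent_RVs U.
  by apply: (@independent_RVs_comp _ _ _ _ _ _ _ _ _ Z U g).
have b0 : 0 < 2 `^ (q - 1) * (1 + 2 `^ q) * M `^ q.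
  by rewrite !mulr_gt0 ?powR_gt0// addr_gt0// powR_gt0.
have Uq i : (\int[P]_om (`|U i om| `^ q)%:E <=
    (2 `^ (q - 1) * (1 + 2 `^ q) * M `^ q)%:E)%E.
  apply: (@centered_moment _ _ _ P q M (m i) (V i)) => //.
    exact: increment_moment.
  exact: integral_increment.
have iU i : P.-integrable setT (EFin \o U i).
  rewrite (_ : EFin \o U i =
    (fun om => (Z i om t - Z i om 0)%:E) \- (fun=> (m i)%:E))%E//.
  apply: integrableB => //; first exact: integrable_increment.
  exact: finite_measure_integrable_cst.
have U0 i : (\int[P]_om (U i om)%:E = 0)%E.
  rewrite (_ : \int[P]_om _ =
    \int[P]_om ((Z i om t - Z i om 0)%:E - (m i)%:E))%E//.
  rewrite integralB//.
  - rewrite integral_increment// integral_cst//.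
    by rewrite [X in (_ - _ * X)%E](probability_setT P) mule1 -EFinB subrr.
  - exact: integrable_increment.
  - exact: finite_measure_integrable_cst.
have NU := @independent_sum_moment _ _ _ P q _ N U q2 b0 indU Uq iU U0.
rewrite (_ : \int[P]_om _ = \int[P]_om ((N%:R `^ (- q))%:E *
   (`|\sum_(i < N) U i om| `^ q)%:E))%E; last first.
  apply: eq_integral => om _; rewrite -EFinM; congr (_%:E).
  rewrite (_ : _ - _ = N%:R^-1 * \sum_(i < N) U i om).
    rewrite normrM powRM// normfV (gtr0_norm NR0); congr (_ * _).
    by rewrite -powR_inv1 ?ltW// -powRrM mulN1r.
  rewrite /= /g /m !sumrB /average /mean_average; ring.
rewrite ge0_integralZl//; last first.
  apply/measurable_EFinP; apply: measurable_powR_norm.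
  by apply: measurable_sum => i.
apply: (le_trans (lee_wpmul2l _ NU)); first by rewrite lee_fin powR_ge0.
rewrite -EFinM lee_fin.
have -> : N%:R `^ (- (q / 2)) = N%:R `^ (- q) * N%:R `^ (q / 2) :> R.
  by rewrite -powRD ?(gt_eqF NR0) ?implybT//; congr (_ `^ _); field.
rewrite le_eqVlt; apply/orP; left; apply/eqP; ring.
Qed.

(** A single measurable variable dominates all the centred increments: the
grid sum of [increment_sup_bound], for the mesh of [mesh_size]. *)
Lemma average_dominated :
  exists W : Omega -> R, [/\ measurable_fun setT W, forall om, 0 <= W om,
    forall om (s t : R), s \in `[0, T] -> t \in `[0, T] ->
      `|(average om t - mean_average t) - (average om s - mean_average s)| `^ q
      <= W om &
    (\int[P]_om (W om)%:E <=
      ((M `^ q * 2 `^ (q - 1))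
            / (N%:R `^ (q ^+ 2 * r / (2 * q * r + 2 * r + 2)))
          * (increment_const q `^ q *
               (2 * T * (N%:R^-1 * \sum_(i < N) w i) `^ r^-1 + 1)
             + 2 `^ (2 * q)))%:E)%E].
Proof.
have q0 : 0 < q by exact: lt_trans q2.
have q1 : 1 <= q by rewrite ltW// (lt_trans _ q2)// ltr1n.
set wbar := N%:R^-1 * \sum_(i < N) w i.
have wbar0 : 0 <= wbar by rewrite mulr_ge0 ?invr_ge0 ?sumr_ge0.
have N1 : 1 <= N%:R :> R by rewrite ler1n.
set D := 2 * q * r + 2 * r + 2.
have [m [m0 mW mN]] := mesh_size q0 r0 T0 wbar0 N1.
have mR : 0 < m%:R :> R by rewrite ltr0n.
pose delta : R := N%:R `^ (- (q * r / D)).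
have e0 : 0 <= M * delta by rewrite mulr_ge0 ?powR_ge0 ?(ltW M0).
have modulus s t : s \in `[0, T] -> t \in `[0, T] -> s <= t ->
    t - s <= T / m%:R -> mean_average t - mean_average s <= M * delta.
  move=> sT tT st tsm; apply: (le_trans (mean_average_modulus sT tT)).
  rewrite -mulrA ler_wpM2l ?(ltW M0)//; apply: le_trans mW.
  rewrite ler_wpM2l// ge0_ler_powR ?nnegrE ?(ltW r0) ?divr_ge0 ?(ltW T0)//.
  by rewrite ger0_norm ?subr_ge0.
pose c : R := 2 `^ (q - 1) * 2 `^ q.
have c0 : 0 <= c by rewrite mulr_ge0 ?powR_ge0.
pose G t om :=
  (average om t - mean_average t) - (average om 0 - mean_average 0).
pose W om := c * (\sum_(j < m) `|G (j.+1%:R * (T / m%:R)) om| `^ q +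
  (M * delta) `^ q).
have gridT (j : 'I_m) : j.+1%:R * (T / m%:R) \in `[0, T].
  rewrite in_itv/= mulr_ge0 ?divr_ge0 ?(ltW T0)//= mulrA ler_pdivrMr// mulrC.
  by rewrite ler_wpM2l ?(ltW T0)// ler_nat.
have maverage t : t \in `[0, T] -> measurable_fun setT (fun om => average om t).
  move=> tT; apply: measurable_funM => //.
  by apply: measurable_sum => i; exact: measurable_eval.
have mG t : t \in `[0, T] -> measurable_fun setT (fun om => `|G t om| `^ q).
  move=> tT; apply: measurable_powR_norm; apply: measurable_funB.
    by apply: measurable_funB => //; exact: maverage.
  by apply: measurable_funB => //; exact: maverage.
have mS : measurable_fun setT
    (fun om => \sum_(j < m) `|G (j.+1%:R * (T / m%:R)) om| `^ q).
  by apply: measurable_sum => j; apply: mG.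
exists W; split.
- by apply: measurable_funM => //; apply: measurable_funD.
- move=> om; apply: mulr_ge0 => //; apply: addr_ge0; last exact: powR_ge0.
  by apply: sumr_ge0 => j _; exact: powR_ge0.
- move=> om s t sT tT.
  exact: (increment_sup_bound q1 T0 m0 e0 (nondecreasing_average om)
    modulus sT tT).
pose K := moment_const q * (2 `^ (q - 1) * (1 + 2 `^ q)).
have K0 : 0 <= K.
  apply: mulr_ge0; first exact: le_trans ler01 (moment_const_ge1 q1).
  by rewrite mulr_ge0 ?addr_ge0 ?powR_ge0.
have CK : increment_const q `^ q = 2 `^ q * K.
  rewrite /increment_const -powRrM mulVf ?gt_eqF// powRr1//.
  by rewrite mulr_ge0 ?powR_ge0.
apply: (@le_trans _ _ (c * (m%:R * (K * M `^ q * N%:R `^ (- (q / 2))) +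
    (M * delta) `^ q))%:E).
  rewrite (_ : \int[P]_om _ = \int[P]_om (c%:E *
    (\sum_(j < m) (`|G (j.+1%:R * (T / m%:R)) om| `^ q)%:E +
     ((M * delta) `^ q)%:E)))%E; last first.
    by apply: eq_integral => om _; rewrite sumEFin.
  rewrite ge0_integralZl//; last 2 first.
  - apply: emeasurable_funD => //; apply: emeasurable_sum => j.
    by apply/measurable_EFinP; exact: mG.
  - move=> om _; apply: adde_ge0; last by rewrite lee_fin powR_ge0.
    by apply: sume_ge0 => j _; rewrite lee_fin powR_ge0.
  rewrite [leRHS]EFinM; apply: lee_wpmul2l; first by rewrite lee_fin.
  rewrite ge0_integralD//; last 3 first.
  - by move=> om _; apply: sume_ge0 => j _; rewrite lee_fin powR_ge0.
  - by apply: emeasurable_sum => j; apply/measurable_EFinP; exact: mG.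
  - by move=> om _; rewrite lee_fin powR_ge0.
  rewrite integral_cst// [X in (_ + _ * X)%E](probability_setT P) mule1.
  rewrite EFinD leeD2r//.
  rewrite ge0_integral_sum//; last first.
    by move=> j; apply/measurable_EFinP; exact: mG.
  have -> : (m%:R * (K * M `^ q * N%:R `^ (- (q / 2))))%:E =
      (\sum_(j < m) (K * M `^ q * N%:R `^ (- (q / 2)))%:E)%E.
    by rewrite sumEFin sumr_const card_ord mulr_natl.
  by apply: lee_sum => j _; exact: average_moment.
have dq : (M * delta) `^ q = M `^ q * N%:R `^ (- (q ^+ 2 * r / D)).
  rewrite powRM ?powR_ge0 ?(ltW M0)// -powRrM; congr (_ * _ `^ _).
  by rewrite mulNr; congr (- _); ring.
rewrite lee_fin dq CK -powRN.
have -> : 2 `^ (2 * q) = 2 `^ q * 2 `^ q :> R.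
  by rewrite -powRD ?pnatr_eq0 ?implybT//; congr (_ `^ _); ring.
have s1 : 1 <= 2 `^ q :> R by apply: powR_ge1; rewrite ?ler1n ?(ltW q0).
have p0 : 0 <= 2 `^ (q - 1) :> R by exact: powR_ge0.
have a0 : 0 <= M `^ q by exact: powR_ge0.
have nu0 : 0 <= N%:R `^ (- (q ^+ 2 * r / D)) :> R by exact: powR_ge0.
have Y0 : 0 <= T * wbar `^ r^-1 by rewrite mulr_ge0 ?powR_ge0 ?(ltW T0).
rewrite -/D in mN; rewrite /c -(mulrA 2 T); move: s1 p0 a0 nu0 Y0 mN.
set s := 2 `^ q; set p := 2 `^ (q - 1); set a := M `^ q.
set nu := N%:R `^ (- (_ * _ / _)); set mu := N%:R `^ _; set Y := T * _.
move=> s1 p0 a0 nu0 Y0 mN.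
(* The difference of the two sides is [h1 + h2 + h3]: the slack in [mN], that
   between [Y + 1] and [2 Y + 1], and that between [2^q] and [2^(2q)]. *)
have s0 : 0 <= s by exact: le_trans ler01 s1.
have h0 : 0 <= p * s * a * K by apply: mulr_ge0 K0; rewrite !mulr_ge0.
have h1 : p * s * a * K * (m%:R * mu) <= p * s * a * K * ((Y + 1) * nu).
  exact: ler_wpM2l h0 _ _ mN.
have h2 : 0 <= p * s * a * K * (Y * nu).
  by apply: mulr_ge0 h0 _; exact: mulr_ge0 Y0 nu0.
have h3 : 0 <= p * s * a * nu * (s - 1) by rewrite !mulr_ge0 ?subr_ge0.
rewrite -subr_ge0; move: h1; rewrite -subr_ge0 => h1.
rewrite (_ : _ - _ =
  (p * s * a * K * ((Y + 1) * nu) - p * s * a * K * (m%:R * mu)) +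
  p * s * a * K * (Y * nu) + p * s * a * nu * (s - 1)).
  by apply: addr_ge0 h3; exact: addr_ge0 h1 h2.
by ring.
Qed.

End processes.

(** * Almost sure convergence from summable integrals *)

Section power_series.
Context (R : realType).

(** From [1 - 1/x <= expR (- 1/x)], raised to the power [- s], one gets
[(x - 1)^(-s) >= x^(-s) expR (s / x) >= x^(-s) (1 + s / x)]. *)
Lemma powR_telescope (s x : R) : 0 < s -> 1 < x ->
  s * x `^ (- (1 + s)) <= (x - 1) `^ (- s) - x `^ (- s).
Proof.
move=> s0 x1; have x0 : 0 < x by lra.
have y0 : 0 < x - 1 by lra.
have xs0 := powR_gt0 (- s) x0.
have -> : x `^ (- (1 + s)) = x `^ (- s) * x^-1.
  rewrite -[x^-1]powR_inv1 ?(ltW x0)// -powRD ?(gt_eqF x0) ?implybT//.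
  by congr (_ `^ _); ring.
have ye : x - 1 <= x * expR (- x^-1).
  have := expR_ge1Dx (- x^-1); rewrite -(ler_pM2l x0) mulrBr mulr1 mulfV//.
  by rewrite gt_eqF.
have yse : (x - 1) `^ s <= x `^ s * expR (- x^-1 * s).
  rewrite expRM -powRM ?expR_ge0 ?(ltW x0)//.
  apply: ge0_ler_powR; rewrite ?nnegrE ?(ltW s0) ?(ltW y0)//.
  by rewrite mulr_ge0 ?expR_ge0 ?(ltW x0).
have : x `^ (- s) * expR (x^-1 * s) <= (x - 1) `^ (- s).
  rewrite !powRN -[X in _ * X]invrK -expRN -invfM lef_pV2 ?posrE ?powR_gt0//.
    by rewrite -mulNr.
  by rewrite mulr_gt0 ?powR_gt0 ?expR_gt0.
have := expR_ge1Dx (x^-1 * s); rewrite -(ler_pM2l xs0); lra.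
Qed.

(** The terms from [k = 2] on telescope by [powR_telescope]; the term [k = 0] is
zero, as [0] raised to a nonzero exponent is [0]. *)
Lemma powR_sum_bounded (s : R) (n : nat) : 0 < s ->
  \sum_(0 <= k < n) k%:R `^ (- (1 + s)) <= 1 + s^-1.
Proof.
move=> s0; have s10 : 1 + s != 0 by rewrite gt_eqF// addr_gt0.
have step m : \sum_(0 <= k < m.+2) k%:R `^ (- (1 + s)) <=
    1 + s^-1 * (1 - m.+1%:R `^ (- s)).
  elim: m => [|m IH].
    rewrite big_nat_recr//= big_nat1 powR0 ?oppr_eq0// !powR1.
    by rewrite subrr mulr0 addr0 add0r.
  rewrite big_nat_recr//=; apply: le_trans (lerD IH (lexx _)) _.
  have m1 : 1 < m.+2%:R :> R by rewrite ltr1n.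
  have := powR_telescope s0 m1.
  have -> : m.+2%:R - 1 = m.+1%:R :> R by rewrite -[m.+2]addn1 natrD addrK.
  have si : 0 < s^-1 by rewrite invr_gt0.
  rewrite -(ler_pM2l si) mulrA mulVf ?gt_eqF// mul1r; lra.
apply: (@le_trans _ _ (\sum_(0 <= k < n.+2) k%:R `^ (- (1 + s)))).
  by rewrite big_nat_recr//= big_nat_recr//= -addrA lerDl addr_ge0 ?powR_ge0.
apply: (le_trans (step n)); by rewrite lerD2l ler_piMr ?invr_ge0 ?(ltW s0).
Qed.

End power_series.

Section summable_moments.
Context d (Omega : measurableType d) (R : realType) (P : probability Omega R).
Local Open Scope ereal_scope.

(** The series of the [W n] has a finite integral, so it converges almost
everywhere, and its tails dominate its terms. *)
Lemma ae_cvg0_of_summable_integral (W : nat -> Omega -> R) (a : nat -> R)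
    (B : R) :
  (forall n, measurable_fun setT (W n)) -> (forall n om, (0 <= W n om)%R) ->
  (forall n, \int[P]_om (W n om)%:E <= (a n)%:E) ->
  (forall n, \sum_(0 <= k < n) a k <= B)%R ->
  {ae P, forall om, W n om @[n --> \oo] --> 0%R}.
Proof.
move=> mW W0 Wa aB.
pose S om := \sum_(n <oo) (W n om)%:E.
have mS : measurable_fun setT S.
  apply: ge0_emeasurable_sum => // k.
  - by move=> om _ _; rewrite lee_fin.
  - by move=> _; apply/measurable_EFinP.
have S0 om : 0 <= S om by apply: nneseries_ge0 => n _ _; rewrite lee_fin.
have SB : \int[P]_om S om <= B%:E.
  rewrite integral_nneseries//; last 2 first.
  - by move=> n; exact/measurable_EFinP.
  - by move=> n om _; rewrite lee_fin.
  apply: lime_le.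
    apply: is_cvg_nneseries => n _ _.
    by apply: integral_ge0 => om _; rewrite lee_fin.
  apply: nearW => n; apply: (@le_trans _ _ (\sum_(0 <= k < n) (a k)%:E)).
    by apply: lee_sum => k _.
  by rewrite sumEFin lee_fin.
have iS : P.-integrable setT S.
  apply/integrableP; split => //.
  under eq_integral do rewrite gee0_abs//.
  by rewrite (le_lt_trans SB)// ltry.
have := integrable_ae measurableT iS.
apply: filterS => om /(_ I) Sfin.
have Soo : \sum_(0 <= n <oo) (W n om)%:E < +oo.
  by rewrite -ge0_fin_numE//; exact: S0.
have tail := nneseries_tail_cvg Soo (fun k _ => W0 k om : 0 <= (W k om)%:E).
apply: (@fine_cvg _ _ _ _ (fun n => (W n om)%:E) 0%R).
apply: (squeeze_cvge _ (cvg_cst 0) tail).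
apply: nearW => n; rewrite lee_fin W0 /=.
have := @nneseries_lim_ge R (fun n => (W n om)%:E) xpredT n n.+1.
by rewrite big_nat1; apply => k _ _; rewrite lee_fin.
Qed.

End summable_moments.

(** * The uniform law of large numbers *)

Lemma increment_const_gt0 (R : realType) (q : R) :
  1 <= q -> 0 < increment_const q.
Proof.
move=> q1; have A0 := lt_le_trans ltr01 (moment_const_ge1 q1).
apply: powR_gt0; apply: mulr_gt0; first exact: powR_gt0.
by apply: (mulr_gt0 A0); rewrite mulr_gt0 ?addr_gt0 ?powR_gt0.
Qed.

Lemma ereal_sup_image_ge0 (R : realType) (I : Type) (D : set I) (x : I)
    (f : I -> \bar R) : D x -> (forall y, (0 <= f y)%E) ->
  (0 <= ereal_sup [set f y | y in D])%E.
Proof.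
by move=> Dx f0; apply: le_ereal_sup_tmp; exists (f x) => //; exists x.
Qed.

Lemma Delta_in (R : realType) (T : R) (t : R * R) : Delta T t ->
  t.1 \in `[0, T] /\ t.2 \in `[0, T].
Proof.
case=> t0 t12 tT; rewrite !in_itv/= t0 tT.
by rewrite (le_trans t12 tT) (le_trans t0 t12).
Qed.

(* Expectations are the extended-real valued ones of the library.  In
   hypothesis (ii) a non-integrable Z_i(t) makes the left-hand side +oo for
   s = t, so (ii) includes the existence of the expectations E[Z_i(t)]. *)
Theorem corollary2 (R : realType) (q : R) (hq : 2 < q) :
  exists C : R, 0 < C /\
  forall (T : R) (hT : 0 < T)
    (d : measure_display) (Omega : measurableType d) (P : probability Omega R)
    (r : R) (hr : 0 < r)
    (Z : forall N : nat, 'I_N -> {RV P >-> Dup T})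
    (M : nat -> R) (w : forall N : nat, 'I_N -> R)
    (hZ : forall N, (0 < N)%N -> independent_RVs (Z N))
    (hM : forall N, (0 < N)%N -> 0 < M N)
    (hw : forall N (i : 'I_N), 0 <= w N i)
    (hi : forall N (i : 'I_N),
      ('E_P[fun om => (`|Z N i om T - Z N i om 0| `^ q)%R] `^ q^-1 <= (M N)%:E)%E)
    (hii : forall N (i : 'I_N) (s t : R), s \in `[0, T] -> t \in `[0, T] ->
      (`|'E_P[fun om => Z N i om t] - 'E_P[fun om => Z N i om s]|
         <= (M N * w N i * `|t - s| `^ r)%:E)%E),
  let wbar := fun N : nat => N%:R^-1 * \sum_(i < N) w N i in
  let Y := fun (N : nat) (t : R) (om : Omega) =>
    N%:R^-1 * \sum_(i < N) Z N i om t in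
  (forall N0 : nat,
     smallest_positive
       (fun n => 2 <= n%:R `^ (q * r / (2 * q * r + 2 * r + 2))) N0 ->
     forall N : nat, (N0 <= N)%N ->
     (\int[P]_om ereal_sup
        [set `|(Y N t.2 om - Y N t.1 om)%:E
               - 'E_P[fun om' => (Y N t.2 om' - Y N t.1 om')%R]| `^ q
        | t in Delta T]
      <= ((M N `^ q * 2 `^ (q - 1))
            / (N%:R `^ (q ^+ 2 * r / (2 * q * r + 2 * r + 2)))
          * (C `^ q * (2 * T * wbar N `^ r^-1 + 1) + 2 `^ (2 * q)))%:E)%E)
  /\
  (bounded_fun M -> bounded_fun wbar -> 2 < (q ^+ 2 - 2 * q - 2) * r ->
   {ae P, forall om,
     (fun N : nat => ereal_sup
        [set `|(N%:R^-1)%:E * \sum_(i < N)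
                 ((Z N i om t.2 - Z N i om t.1)%:E
                  - 'E_P[fun om' => (Z N i om' t.2 - Z N i om' t.1)%R])|%E
        | t in Delta T]) @ \oo --> 0%E}).
Proof.
have q0 : 0 < q by exact: lt_trans hq.
have q1 : 1 <= q by rewrite ltW// (lt_trans _ hq)// ltr1n.
exists (increment_const q); split; first exact: increment_const_gt0.
move=> T hT d Omega P r hr Z M w hZ hM hw hi hii wbar Y.
set D := 2 * q * r + 2 * r + 2.
have D0 : 0 < D by rewrite /D !addr_gt0 ?mulr_gt0.
have dom N (N0 : (0 < N)%N) := average_dominated hq hT hr N0 (hM N N0)
  (@hw N) (hZ N N0) (@hi N) (@hii N).
have D00 : Delta T (0, 0) by split => //=; exact: ltW.
split.
  move=> N0 [N0_gt0 _ _] N N0N; have N_gt0 := leq_trans N0_gt0 N0N.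
  have [W [mW W0 YW]] := dom N N_gt0; apply: le_trans.
  apply: ge0_le_integral_nonmeasurable => om.
    by apply: ereal_sup_image_ge0 D00 _ => t; exact: poweR_ge0.
  apply: ge_ereal_sup => _ [t /Delta_in[t1 t2] <-].
  rewrite (expectation_average_increment (@hii N) t1 t2) -EFinB.
  rewrite poweR_EFin lee_fin.
  apply: le_trans (YW om t.1 t.2 t1 t2); rewrite le_eqVlt; apply/orP; left.
  by apply/eqP; congr (`| _ | `^ _); rewrite /Y /average; ring.
move=> [Mb [_ /(_ (Mb + 1) (ltr_pwDr ltr01 (lexx _))) hMb]].
move=> [wb [_ /(_ (wb + 1) (ltr_pwDr ltr01 (lexx _))) hwb]] hqr.
set E := q ^+ 2 * r / D.
have E1 : 1 < E by rewrite /E ltr_pdivlMr// mul1r /D; move: hqr; lra.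
pose s := E - 1; have s0 : 0 < s by rewrite subr_gt0.
have sE : 1 + s = E by rewrite /s addrCA subrr addr0.
pose B := (Mb + 1) `^ q * 2 `^ (q - 1) *
  (increment_const q `^ q * (2 * T * (wb + 1) `^ r^-1 + 1) + 2 `^ (2 * q)).
have wbar0 N : 0 <= wbar N by rewrite mulr_ge0 ?invr_ge0 ?sumr_ge0.
have MB N : M N <= Mb + 1 by apply: le_trans (ler_norm _) _; exact: hMb.
have wB N : wbar N <= wb + 1 by apply: le_trans (ler_norm _) _; exact: hwb.
have B0 : 0 <= B.
  by rewrite !(mulr_ge0, addr_ge0, powR_ge0)// ltW.
(* At [N = 0] this is [0], which matches the choice [W = 0] there. *)
pose a (N : nat) := B * N%:R `^ (- (1 + s)).
have a0 N : 0 <= a N by rewrite mulr_ge0 ?powR_ge0.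
have /choice[W HW] : forall N, exists W : Omega -> R,
    [/\ measurable_fun setT W, forall om, 0 <= W om,
    (0 < N)%N -> forall om s t, s \in `[0, T] -> t \in `[0, T] ->
      `|(average (Z N) om t - mean_average (Z N) t) -
        (average (Z N) om s - mean_average (Z N) s)| `^ q <= W om &
    (\int[P]_om (W om)%:E <= (a N)%:E)%E].
  case=> [|N].
    exists (cst 0); split => //.
    by rewrite integral0 lee_fin.
  have [W [mW W0 YW WI]] := dom N.+1 isT; exists W; split => //.
  apply: (le_trans WI); rewrite lee_fin -/D -/E -/(wbar N.+1) /a sE.
  rewrite powRN mulrAC [B * _]mulrC [leRHS]mulrC.
  rewrite ler_wpM2r ?invr_ge0 ?powR_ge0// /B.
  have M0 := hM N.+1 isT.
  apply: ler_pM.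
  - by rewrite mulr_ge0 ?powR_ge0.
  - by rewrite !(addr_ge0, mulr_ge0, powR_ge0)// ltW.
  - rewrite ler_wpM2r ?powR_ge0//; apply: ge0_ler_powR; rewrite ?nnegrE//.
    + exact: ltW.
    + exact: ltW.
    + exact: le_trans (ltW M0) (MB _).
  rewrite lerD2r ler_wpM2l ?powR_ge0// lerD2r ler_wpM2l ?mulr_ge0 ?(ltW hT)//.
  by rewrite ge0_ler_powR ?nnegrE ?invr_ge0 ?(ltW hr)// (le_trans (wbar0 N.+1)).
have aB n : \sum_(0 <= k < n) a k <= B * (1 + s^-1).
  by rewrite -mulr_sumr ler_wpM2l// powR_sum_bounded.
have := @ae_cvg0_of_summable_integral _ _ _ P W a _
  (fun N => let: And4 h _ _ _ := HW N in h)
  (fun N => let: And4 _ h _ _ := HW N in h)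
  (fun N => let: And4 _ _ _ h := HW N in h) aB.
apply: filterS => om Wom.
have W0 N : 0 <= W N om by have [_ h _ _] := HW N.
have Wq : (W N om `^ q^-1) @[N --> \oo] --> 0.
  apply/cvgr0Pnorm_le => e e0.
  have := Wom; move/cvgr0Pnorm_le => /(_ (e `^ q) (powR_gt0 q e0)).
  apply: filterS => N; rewrite !ger0_norm ?powR_ge0// => We.
  have -> : e = (e `^ q) `^ q^-1 by rewrite -powRrM mulfV ?gt_eqF// powRr1 ?ltW.
  by rewrite ge0_ler_powR ?nnegrE ?powR_ge0 ?invr_ge0 ?(ltW q0).
apply: (@squeeze_cvge _ _ _ _ (fun=> 0%E) _ (fun N => (W N om `^ q^-1)%:E)).
- near=> N; have N_gt0 : (0 < N)%N by near: N; exact: nbhs_infty_gt.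
  apply/andP; split.
    by apply: ereal_sup_image_ge0 D00 _ => t; exact: abse_ge0.
  apply: ge_ereal_sup => _ [t /Delta_in[t1 t2] <-].
  under eq_bigr do rewrite (expectation_increment (@hii N) _ t1 t2) -EFinB.
  rewrite sumEFin -EFinM lee_fin.
  have [_ _ YW _] := HW N; have := YW N_gt0 om t.1 t.2 t1 t2.
  rewrite (_ : average _ _ _ - _ - _ = N%:R^-1 * \sum_(i < N)
    (Z N i om t.2 - Z N i om t.1 -
     (mean_path (Z N) i t.2 - mean_path (Z N) i t.1))).
    move=> /(ge0_ler_powR (_ : 0 <= q^-1)); rewrite invr_ge0 (ltW q0).
    move=> /(_ isT); rewrite !nnegrE !powR_ge0 W0 => /(_ isT isT).
    by rewrite -powRrM mulfV ?gt_eqF// powRr1.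
  rewrite !sumrB /average /mean_average; ring.
- exact: cvg_cst.
- by apply: cvg_EFin => //; apply: nearW.
Unshelve. all: by end_near.
Qed.
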